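(* Fix $k\ge 3$. If $N,n,r,s$ are positive integers with $n>k$, $1\le s\le r/2$ and $R_k(n;r,s)>N>0$, then $R_{k+1}(2n-1;r,s)>2^N$.
   Context: For positive integers $n,k,r,s$ with $n>k$ and $r>s$, an $(r,s)$-coloring of the complete $k$-uniform hypergraph $K_N^{(k)}$ is a map $\chi:E(K_N^{(k)})\to\binom{[r]}{s}$. A monochromatic $n$-clique is a set of $n$ vertices such that all $\binom{n}{k}$ edges within it contain a common color. $R_k(n;r,s)$ is the minimum $N$ such that every $(r,s)$-coloring of $K_N^{(k)}$ contains a monochromatic $n$-clique. *)

(* Defs.v *)
From mathcomp Require Import all_boot.

Set Implicit Arguments.
Unset Strict Implicit.
Unset Printing Implicit Defensive.

Definition edge (k N : nat) : finType := {e : {set 'I_N} | #|e| == k}.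
Definition palette (r s : nat) : finType := {C : {set 'I_r} | #|C| == s}.
Definition coloring (k N r s : nat) : finType :=
  {ffun edge k N -> palette r s}.

Definition monochromatic (k N r s : nat) (chi : coloring k N r s)
    (A : {set 'I_N}) : bool :=
  [exists c : 'I_r, [forall e : edge k N,
    (val e \subset A) ==> (c \in val (chi e))]].

Definition forces_clique (k n r s N : nat) : bool :=
  [forall chi : coloring k N r s,
    [exists A : {set 'I_N}, (#|A| == n) && monochromatic chi A]].

(* Ramsey's theorem for single-valued colorings, in off-diagonal form: [n c]  *)
(* is the size required of a set that is homogeneous in color c. It is needed *)
(* only for [forces_clique_ex], which makes [ramsey_number] well defined.     *)
Lemma ramsey_offdiag (r k : nat) (n : 'I_r -> nat) :
  exists N, forall (T : finType) (V : {set T}) (f : {set T} -> 'I_r),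
    N <= #|V| -> exists c (A : {set T}),
      [/\ A \subset V, #|A| = n c &
          forall e : {set T}, e \subset A -> #|e| = k -> f e = c].
Proof.
elim: k n => [|k IHk] n.
  exists (\max_c n c) => T V f leV; exists (f set0).
  have [A sAV cA] : exists2 A : {set T}, A \subset V & #|A| = n (f set0).
    have le_nV : n (f set0) <= #|V| by apply: leq_trans (leq_bigmax _) leV.
    have [s [us ss sV]] := card_geqP le_nV.
    exists [set x in s]; first by apply/subsetP => x; rewrite inE => /sV.
    by rewrite cardsE (card_uniqP us).
  by exists A; split=> // e _ /eqP; rewrite cards_eq0 => /eqP->.
have [m] := ubnP (\sum_c n c); elim: m n => // m IHm n lt_n_m.
have [c0 /eqP nc0|] := pickP (fun c => n c == 0).
  exists 0 => T V f _; exists c0, set0; split; rewrite ?sub0set ?cards0 //.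
  by move=> e; rewrite subset0 => /eqP->; rewrite cards0.
move=> n_neq0; pose n' c d := if d == c then (n d).-1 else n d.
have lt_n' c : \sum_d n' c d < m.
  rewrite -ltnS; apply: leq_ltn_trans lt_n_m.
  rewrite (bigD1 c) //= [leqRHS](bigD1 c) //= /n' eqxx.
  rewrite (eq_bigr n) => [|d /negPf-> //].
  by rewrite -addSn leq_add2r prednK // lt0n n_neq0.
have [M HM] := fin_all_exists (fun c => IHm (n' c) (lt_n' c)).
have [N HN] := IHk M.
exists N.+1 => T V f leV.
have /card_gt0P[v vV] : 0 < #|V| by apply: leq_trans leV.
have leVv : N <= #|V :\ v| by rewrite -ltnS (leq_trans leV) // (cardsD1 v V) vV.
have [c [A [sAV cA hA]]] := HN T (V :\ v) (fun e => f (v |: e)) leVv.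
have [d [B [sBA cB hB]]] := HM c T A f (eq_leq (esym cA)).
have sBV : B \subset V :\ v by apply: subset_trans sAV.
move: cB; rewrite /n'; have [dc|_] := eqVneq d c => cB; last first.
  by exists d, B; split=> //; apply: subset_trans sBV (subD1set _ _).
rewrite {d}dc in cB hB.
have vB : v \notin B by apply/negP => /(subsetP sBV); rewrite !inE eqxx.
exists c, (v |: B); split.
- by rewrite subUset sub1set vV (subset_trans sBV) ?subD1set.
- by rewrite cardsU1 vB cB add1n prednK // lt0n n_neq0.
move=> e seB ce; have [ve|ve] := boolP (v \in e).
  rewrite -(setD1K ve) hA //.
    by rewrite (subset_trans _ sBA) // subDset.
  by move: ce; rewrite (cardsD1 v) ve => -[].
by apply: hB => //; rewrite -(setU1K vB) subsetD1 seB.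
Qed.

Lemma forces_clique_ex (k n r s : nat) :
  0 < s -> exists N, forces_clique k n r s N.
Proof.
move=> s_gt0; case: r => [|r].
  exists k; apply/forallP => chi.
  have cT : #|[set: 'I_k]| == k by rewrite cardsT card_ord.
  case: (chi (Sub [set: 'I_k] cT)) => C /eqP sC.
  have /card_gt0P[[]//] : 0 < #|C| by rewrite sC.
have [N HN] := @ramsey_offdiag r.+1 k (fun=> n).
exists N; apply/forallP => chi.
pose f (e : {set 'I_N}) : 'I_r.+1 :=
  if insub e is Some e' then odflt ord0 [pick c in val (chi e')] else ord0.
have fP (e : edge k N) : f (val e) \in val (chi e).
  rewrite /f valK; case: pickP => //= chi0.
  have := valP (chi e); rewrite (eq_card0 chi0) => /eqP s0.
  by rewrite -s0 in s_gt0.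
have [|c [A [_ cA hA]]] := HN 'I_N [set: 'I_N] f; first by rewrite cardsT card_ord.
apply/existsP; exists A; rewrite cA eqxx; apply/existsP; exists c.
apply/forallP => e; apply/implyP => seA.
by rewrite -(hA _ seA (eqP (valP e))) fP.
Qed.

(* The hypothesis 0 < s guarantees that the minimum is over a nonempty set.   *)
Definition ramsey_number (k n r s : nat) (s_gt0 : 0 < s) : nat :=
  ex_minn (forces_clique_ex k n r s_gt0).
Arguments ramsey_number k n r s s_gt0 : clear implicits.

(* Main.v *)
(* Stepping up. Identify the vertices with numbers below [2 ^ N] and send an  *)
(* increasing list of vertices to the list of positions [delta] of the        *)
(* highest binary digit in which neighbours differ; neighbouring positions    *)
(* are distinct. As 2s <= r, there are two disjoint palettes. An edge whose   *)
(* positions are monotone is colored by the given coloring of its set of      *)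
(* positions; any other edge gets one of the two palettes, according to       *)
(* whether its positions start with an ascent or with a descent. In a clique  *)
(* on 2n - 1 vertices with common color c, one palette misses c, so every     *)
(* window of k positions that starts in the corresponding direction is        *)
(* monotone. This forces n consecutive monotone positions, and they form a    *)
(* monochromatic n-clique of the original coloring, because every subset of   *)
(* a monotone run of positions is the list of positions of some edge.         *)
Require Import Defs.
From mathcomp Require Import all_boot zify.
Set Implicit Arguments.
Unset Strict Implicit.
Unset Printing Implicit Defensive.

(** A clique on [2 * n - 1] vertices has [2 * n - 2] positions, hence [2 * n - 3] ascents or
    descents, each of them strict by [delta_neq]. [long_run] finds [n - 1] consecutive equal ones,
    that is, [n] monotone positions. By [delta_max], [gaps_decr] and [gaps_incr] realize any subset
    of these by an edge, so [step_color_clique] finds the clique of [chi]. *)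

(** * Highest differing binary digit *)

Lemma delta_subproof x y : exists d, x %/ 2 ^ d.+1 == y %/ 2 ^ d.+1.
Proof.
exists (x + y); have lt z : z <= x + y -> z < 2 ^ (x + y).+1.
  by move=> le_z; apply: leq_ltn_trans le_z (ltnW (ltn_expl _ _)).
by rewrite !divn_small // lt ?leq_addl ?leq_addr.
Qed.

(* The position of the highest binary digit in which [x] and [y] differ       *)
(* (junk value [0] when [x = y]).                                             *)
Definition delta x y : nat := ex_minn (delta_subproof x y).

Lemma delta_le x y e : (delta x y <= e) = (x %/ 2 ^ e.+1 == y %/ 2 ^ e.+1).
Proof.
rewrite /delta; case: ex_minnP => d /eqP eq_d min_d.
apply/idP/idP => [le_de|/min_d//].
by rewrite -(subnKC le_de) -addSn expnD !divnMA eq_d.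
Qed.

Lemma delta_lt N x y : x < y < 2 ^ N -> delta x y < N.
Proof.
case/andP; case: N => [|N] lt_xy lt_y; first by move: lt_y; case: y lt_xy.
by rewrite ltnS delta_le !divn_small // (ltn_trans lt_xy).
Qed.

(** Quotients by [2 ^ e.+1] are monotone, so those of the outer two agree exactly when all three
    agree. *)
Lemma delta_max x y z : x <= y <= z -> delta x z = maxn (delta x y) (delta y z).
Proof.
move=> /andP[le_xy le_yz].
have eq_le e : (delta x z <= e) = (maxn (delta x y) (delta y z) <= e).
  rewrite geq_max !delta_le; have := leq_div2r (2 ^ e.+1) le_xy.
  have := leq_div2r (2 ^ e.+1) le_yz.
  move: (x %/ _) (y %/ _) (z %/ _) => a b c le_bc le_ab.
  apply/eqP/andP => [eq_ac|[/eqP-> /eqP->]//].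
  by split; rewrite eqn_leq ?le_bc ?le_ab // ?eq_ac // -eq_ac.
by apply/eqP; rewrite eqn_leq eq_le leqnn -eq_le leqnn.
Qed.

Lemma delta_ltE x y e :
  x <> y -> (delta x y < e) = (x %/ 2 ^ e == y %/ 2 ^ e).
Proof.
by case: e => [|e] neq_xy; [rewrite !divn1; apply/esym/eqP | rewrite ltnS delta_le].
Qed.

(* Three numbers with pairwise distinct quotients by [2 ^ d] cannot have the  *)
(* same quotient by [2 ^ d.+1].                                               *)
Lemma delta_neq x y z : x < y < z -> delta x y <> delta y z.
Proof.
move=> /andP[lt_xy lt_yz] eq_d; set d := delta x y in eq_d.
have := leqnn d; rewrite {1}eq_d delta_le; have := leqnn d; rewrite delta_le.
have := ltnn d; rewrite {1}eq_d delta_ltE; last lia.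
have := ltnn d; rewrite delta_ltE; last lia.
have := leq_div2r (2 ^ d) (ltnW lt_xy); have := leq_div2r (2 ^ d) (ltnW lt_yz).
rewrite !expnSr !divnMA.
move: (x %/ _) (y %/ _) (z %/ _) => a b c le_bc le_ab.
move=> /eqP neq_ab /eqP neq_bc /eqP eq_ab /eqP eq_bc.
lia.

Qed.

(** * Positions of an increasing list *)

Definition gaps (s : seq nat) := pairmap delta (head 0 s) (behead s).

Section Gaps.

Variables (L : nat) (w : nat -> nat).
Hypothesis w_lt : forall i j, i < j < L -> w i < w j.
Let d i := delta (w i) (w i.+1).

Lemma delta_decr i j : i < j < L ->
  (forall l, i < l < j -> d l < d i) -> delta (w i) (w j) = d i.
Proof.
elim: j => // j IHj ltj dec; have [<-//|neq_ij] := eqVneq i j.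
rewrite (@delta_max _ (w j)) ?IHj; try lia.
- by apply/maxn_idPl/ltnW/dec; lia.
- by move=> l ltl; apply: dec; lia.
by apply/andP; split; apply/ltnW/w_lt; lia.
Qed.

Lemma delta_incr i j : i <= j -> j.+1 < L ->
  (forall l, i <= l < j -> d l < d j) -> delta (w i) (w j.+1) = d j.
Proof.
move=> leij ltj; have [k ->] : exists k, i = j - k by exists (j - i); lia.
elim: k => [|k IHk] inc; first by rewrite subn0.
have [le_jk|lt_kj] := leqP j k.
  have eq_k : j - k.+1 = j - k by lia.
  by rewrite eq_k in inc *; apply: IHk.
rewrite (@delta_max _ (w (j - k))) ?IHk.
- rewrite (_ : j - k = (j - k.+1).+1); last lia.
  by apply/maxn_idPr/ltnW/inc; lia.
- by move=> l ltl; apply: inc; lia.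
by apply/andP; split; apply/ltnW/w_lt; lia.
Qed.

Lemma gaps_iota a k : gaps (map w (iota a k.+1)) = map d (iota a k).
Proof. by elim: k a => //= k IHk a; rewrite -IHk. Qed.

(** On a descending run the leftmost position of a stretch dominates, so each index in [J] serves as
    a left end and only a final vertex [m] is added. *)
Lemma gaps_decr J m : m < L -> sorted ltn (rcons J m) ->
  (forall i l, i \in J -> i < l < m -> d l < d i) ->
  gaps (map w (rcons J m)) = map d J.
Proof.
move=> ltm; case: J => //= i J; rewrite /gaps /=.
elim: J i => [|j J IHJ] i /=.
  by rewrite andbT => lt_im dec; rewrite delta_decr ?lt_im // => l; apply/dec/mem_head.
move=> /andP[lt_ij sJ] dec; rewrite IHJ //; last first.
  by move=> l l' ?; apply: dec; rewrite inE orbC; apply/orP; left.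
have lt_jm : j < m.
  have := order_path_min ltn_trans sJ => /allP; apply.
  by rewrite mem_rcons mem_head.
rewrite delta_decr //; first lia.
by move=> l ltl; apply: dec; rewrite ?mem_head //; lia.
Qed.

(** On an ascending run the rightmost position dominates, so the successors of [J] serve as right
    ends, after an initial vertex [a]. *)
Lemma gaps_incr a J : path ltn a (map S J) -> all (fun j => j.+1 < L) J ->
  (forall l j, j \in J -> a <= l < j -> d l < d j) ->
  gaps (map w (a :: map S J)) = map d J.
Proof.
rewrite /gaps /=; elim: J a => //= j J IHJ a /andP[lt_aj sJ] /andP[ltj allJ] inc.
rewrite delta_incr ?IHJ // => [l l' l'J ?|l ?]; apply: inc; rewrite ?mem_head //.
  by rewrite inE l'J orbT.
lia.
Qed.

End Gaps.

(* In the [2 * m - 1] ascents and descents [u], either some [b] occurs among  *)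
(* the first [m] and then propagates to the end, or none does.                *)
Lemma long_run (u : nat -> bool) b m l : 1 < l <= m ->
  (forall a, a + l <= 2 * m - 1 -> u a = b -> forall j, j < l -> u (a + j) = b) ->
  exists a b', a + m <= 2 * m - 1 /\ forall i, i < m -> u (a + i) = b'.
Proof.
move=> /andP[l_gt1 le_lm] win.
have [/hasP[q]|/hasPn no_b] := boolP (has (fun q => u q == b) (iota 0 m)); last first.
  exists 0, (~~ b); split=> [|i ltim]; first lia.
  have := no_b i; rewrite mem_iota ltim => /(_ isT); rewrite negb_eqb.
  by case: (u i); case: (b).
rewrite mem_iota => ltqm /eqP uq; exists q, b.
have prop j : q + j + l <= 2 * m - 1 -> u (q + j) = b.
  elim: j => [|j IHj] lej; first by rewrite addn0.
  by rewrite addnS -addn1; apply: win => //; try apply: IHj; lia.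
split=> [|i ltim]; first lia.
have [le_i|gt_i] := leqP (q + i + l) (2 * m - 1); first exact: prop.
(* The remaining indices lie in the last window, which starts at [2 * m - 1 - l]. *)
have -> : q + i = q + (2 * m - 1 - l - q) + (q + i - (2 * m - 1 - l)) by lia.
by apply: win; [|apply: prop|]; lia.
Qed.

Lemma card_set_seq N (s : seq nat) : uniq s -> all (fun i => i < N) s ->
  #|[set x : 'I_N | val x \in s]| = size s.
Proof.
move=> us /allP s_lt; rewrite cardE -(size_map val); apply/perm_size/uniq_perm => //.
  by rewrite map_inj_uniq ?enum_uniq //; apply: val_inj.
move=> i; apply/mapP/idP => [[x]|si]; first by rewrite mem_enum inE => ? ->.
by exists (Ordinal (s_lt i si)); rewrite ?mem_enum ?inE.
Qed.

Lemma sorted_val_enum N (A : {set 'I_N}) : sorted ltn (map val (enum A)).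
Proof.
have : subseq (map val (enum A)) (iota 0 N).
  by rewrite -val_enum_ord map_subseq // [enum A]/enum_mem -enumT filter_subseq.
by move/(subseq_sorted ltn_trans); apply; apply: iota_ltn_sorted.
Qed.

(** * The stepped-up coloring and its cliques *)

Section StepUp.

Variables (k N r s : nat) (chi : coloring k N r s) (pal : bool -> palette r s).

(** [pal true] is a default for lists that do not have exactly [k] distinct entries below [N]. *)
Definition set_color (d : seq nat) : palette r s :=
  if insub [set x : 'I_N | val x \in d] is Some e then chi e else pal true.

Definition step_color (t : seq nat) : palette r s :=
  let d := gaps t in
  if sorted ltn d || sorted gtn d then set_color d
  else pal (nth 0 d 0 < nth 0 d 1).

Hypothesis k_ge3 : 3 <= k.
Hypothesis pal_disj : [disjoint val (pal true) & val (pal false)].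

Lemma step_color_clique n (w : nat -> nat) (c : 'I_r) : k < n ->
    (forall i j, i < j < 2 * n - 1 -> w i < w j) ->
    (forall i, i < 2 * n - 1 -> w i < 2 ^ N) ->
    (forall I, sorted ltn I -> all (fun i => i < 2 * n - 1) I ->
      size I = k.+1 -> c \in val (step_color (map w I))) ->
  exists D : {set 'I_N}, (#|D| == n) && monochromatic chi D.
Proof.
move=> lt_kn w_lt w_ub c_col; pose d i := delta (w i) (w i.+1).
pose u i := d i < d i.+1.
have d_neq i : i.+2 < 2 * n - 1 -> d i <> d i.+1.
  by move=> lti; apply: delta_neq; rewrite !w_lt //; lia.
have d_lt i : i.+1 < 2 * n - 1 -> d i < N.
  by move=> lti; apply: delta_lt; rewrite w_lt ?w_ub //; lia.
have [b c_b] : exists b, c \notin val (pal b).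
  have [c_t|] := boolP (c \in val (pal true)); last by exists true.
  by exists false; rewrite (disjointFr pal_disj c_t).
(* If the [k.+1] consecutive vertices from [a] had non-monotone positions, their edge would be
   colored [pal b], which misses [c]. *)
have win a : a + k.-1 <= 2 * n.-1 - 1 -> u a = b ->
    forall j, j < k.-1 -> u (a + j) = b.
  move=> le_a ua j ltj; rewrite -ua.
  have nth_d i : i < k -> nth 0 (map d (iota a k)) i = d (a + i).
    by move=> lti; rewrite (nth_map 0) ?nth_iota ?size_iota.
  have nth_u i : i < k.-1 ->
      (nth 0 (map d (iota a k)) i < nth 0 (map d (iota a k)) i.+1) = u (a + i).
    by move=> lti; rewrite !nth_d ?addnS //; lia.
  have := c_col (iota a k.+1) (iota_ltn_sorted _ _).
  rewrite size_iota => /(_ _ erefl); rewrite /step_color gaps_iota -/d => c_in.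
  have {c_in}/c_in : all (fun i => i < 2 * n - 1) (iota a k.+1).
    by apply/allP => i; rewrite mem_iota; lia.
  have sz : size (map d (iota a k)) = k by rewrite size_map size_iota.
  case: ifP => [/orP[] /(sortedP 0) sd _|_].
  - have ut i : i < k.-1 -> u (a + i).
      by move=> lti; rewrite -nth_u //; apply: sd; rewrite sz; lia.
    by rewrite ut // -(ut 0) ?addn0 //; lia.
  - have uf i : i < k.-1 -> u (a + i) = false.
      move=> lti; rewrite -nth_u //; apply/negbTE; rewrite -leqNgt ltnW //.
      by apply: sd; rewrite sz; lia.
    by rewrite uf // -(uf 0) ?addn0 //; lia.
  - rewrite nth_u; last lia.
    by rewrite addn0 ua (negPf c_b).
have [|a [b' [le_a run]]] := long_run _ win; first lia.
have mono i j : a <= i -> i < j < a + n -> if b' then d i < d j else d j < d i.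
  move=> le_ai; elim: j => // j IHj ltj.
  have uj : u j = b' by rewrite -(run (j - a)) ?subnKC //; lia.
  have {}uj : if b' then d j < d j.+1 else d j.+1 < d j.
    have /d_neq : j.+2 < 2 * n - 1 by lia.
    by rewrite -uj /u; case: (ltngtP (d j) (d j.+1)).
  have [->//|neq_ij] := eqVneq i j.
  have {IHj}/IHj : i < j < a + n by lia.
  by case: (b') uj => [lt_jS lt_ij|lt_Sj lt_ji]; apply: ltn_trans; eassumption.
have d_inj : {in iota a n &, injective d}.
  move=> i j; rewrite !mem_iota => ai aj eq_d.
  have [lt_ij|lt_ji|//] := ltngtP i j.
    suff: false by [].
    by have := mono i j; rewrite eq_d ltnn if_same; apply; lia.
  suff: false by [].
  by have := mono j i; rewrite eq_d ltnn if_same; apply; lia.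
have d_ltN : all (fun i => i < N) (map d (iota a n)).
  by apply/allP => _ /mapP[i + ->]; rewrite mem_iota => ?; apply: d_lt; lia.
exists [set x : 'I_N | val x \in map d (iota a n)].
rewrite card_set_seq ?map_inj_in_uniq ?iota_uniq // size_map size_iota eqxx /=.
apply/existsP; exists c; apply/forallP => e; apply/implyP => /subsetP sub_e.
(* The indices of the run whose positions make up [e]; there are [k] of them because [d] is
   injective on the run. *)
pose J := [seq i <- iota a n | [exists x in val e, val x == d i]].
have sub_J : subseq J (iota a n) by apply: filter_subseq.
have J_iota i : i \in J -> a <= i < a + n.
  by move/(mem_subseq sub_J); rewrite mem_iota.
have set_J : [set x : 'I_N | val x \in map d J] = val e.
  apply/setP => x; rewrite inE; apply/mapP/idP => [[i]|xe].
    rewrite mem_filter => /andP[/existsP[y /andP[ye /eqP eq_y]] _] eq_x.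
    by rewrite (_ : x = y) //; apply: val_inj; rewrite eq_x eq_y.
  have := sub_e x xe; rewrite inE => /mapP[i ai eq_x]; exists i => //.
  by rewrite mem_filter ai andbT; apply/existsP; exists x; rewrite xe -eq_x /=.
have sJ : sorted ltn J := subseq_sorted ltn_trans sub_J (iota_ltn_sorted a n).
have size_J : size J = k.
  rewrite -(eqP (valP e)) -set_J card_set_seq ?size_map //.
    rewrite map_inj_in_uniq ?(subseq_uniq sub_J) ?iota_uniq //.
    by move=> i j /(mem_subseq sub_J) ai /(mem_subseq sub_J) aj; apply: d_inj.
  by apply/allP => _ /mapP[i /J_iota ? ->]; apply: d_lt; lia.
have -> : chi e = set_color (map d J) by rewrite /set_color set_J valK.
case: b' mono {run} => mono.
- have path_J : path ltn a (map S J).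
    rewrite (path_sortedE ltn_trans) sorted_map sJ andbT all_map.
    by apply/allP => i /J_iota /=; lia.
  have eq_gaps : gaps (map w (a :: map S J)) = map d J.
    apply: (gaps_incr w_lt path_J) => [|i j /J_iota ? ?].
      by apply/allP => i /J_iota; lia.
    by apply: mono; lia.
  have sdJ : sorted ltn (map d J).
    apply: (homo_sorted_in _ _ sJ) => [i j|]; last exact/allP/J_iota.
    by move=> /= ai aj ltij; apply: mono; lia.
  have := c_col (a :: map S J) path_J.
  rewrite /step_color eq_gaps sdJ /= size_map size_J; apply=> //.
  apply/andP; split; first lia.
  by rewrite all_map; apply/allP => i /J_iota /=; lia.
have sJ' : sorted ltn (rcons J (a + n)).
  case: (J) sJ J_iota => //= i J' sJ' J_iota; rewrite rcons_path sJ' /=.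
  by case/andP: (J_iota _ (mem_last i J')).
have eq_gaps : gaps (map w (rcons J (a + n))) = map d J.
  apply: (gaps_decr w_lt _ sJ') => [|i j /J_iota ? ?]; first lia.
  by apply: mono; lia.
have sdJ : sorted gtn (map d J).
  apply: (homo_sorted_in _ _ sJ) => [i j|]; last exact/allP/J_iota.
  by move=> /= ai aj ltij; apply: mono; lia.
have := c_col (rcons J (a + n)) sJ'.
rewrite /step_color eq_gaps sdJ orbT /= size_rcons size_J; apply=> //.
rewrite all_rcons; apply/andP; split; first lia.
by apply/allP => i /J_iota; lia.
Qed.

End StepUp.

(** * Transfer to Ramsey numbers *)

Lemma ex_palette_pair r s : 2 * s <= r ->
  exists pal : bool -> palette r s, [disjoint val (pal true) & val (pal false)].
Proof.
move=> le_sr.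
have sub_card (B : {set 'I_r}) : s <= #|B| ->
      exists2 A : {set 'I_r}, A \subset B & #|A| == s.
  rewrite -bin_gt0 -cards_draws => /card_gt0P[A]; rewrite inE => /andP[sAB cA].
  by exists A.
have [|A _ cA] := sub_card [set: 'I_r]; first by rewrite cardsT card_ord; lia.
have [|B sBA cB] := sub_card (~: A).
  by have := cardsC A; rewrite (eqP cA) card_ord; lia.
exists (fun b => if b then Sub A cA else Sub B cB).
by rewrite !SubK disjoint_sym disjoints_subset.
Qed.

Theorem theorem5p3 (k : nat) (hk : 3 <= k) (N n r s : nat)
    (hn : k < n) (hs : 1 <= s) (hsr : 2 * s <= r) (hN : 0 < N)
    (hR : N < ramsey_number k n r s hs) :
  2 ^ N < ramsey_number k.+1 (2 * n - 1) r s hs.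
Proof.
have /forallPn[chi no_clique] : ~~ forces_clique k n r s N.
  apply: contraL hR; rewrite /ramsey_number -leqNgt.
  by case: ex_minnP => R _ min_R /min_R.
rewrite /ramsey_number; case: ex_minnP => M force_M _; rewrite ltnNge.
apply: contra no_clique => le_M; have [pal pal_disj] := ex_palette_pair hsr.
pose vals (A : {set 'I_M}) := [seq val x | x <- enum A].
(* As [M <= 2 ^ N], the vertices are numbers below [2 ^ N], and [vals] lists an edge in increasing
   order. *)
have [A /andP[/eqP card_A /existsP[c /forallP col_c]]] := existsP
  (forallP force_M [ffun e : edge k.+1 M => step_color chi pal (vals (val e))]).
have size_A : size (vals A) = 2 * n - 1 by rewrite size_map -cardE.
apply/existsP.
have vals_lt i : i \in vals A -> i < M by case/mapP=> x _ ->; apply: ltn_ord.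
apply: (@step_color_clique _ _ _ _ chi pal hk pal_disj n (nth 0 (vals A)) c hn).
- move=> i j ltj; apply: (sorted_ltn_nth ltn_trans); rewrite ?inE ?size_A; try lia.
  exact: sorted_val_enum.
- by move=> i lti; apply: leq_trans le_M; apply/vals_lt/mem_nth; rewrite size_A.
move=> I sI I_lt size_I; set t := map _ I.
have st : sorted ltn t.
  apply: (homo_sorted_in _ I_lt sI) => i j lti ltj.
  by apply: (sorted_ltn_nth ltn_trans 0 (sorted_val_enum A)); rewrite inE size_A.
have t_vals i : i \in t -> i \in vals A.
  by case/mapP=> j /(allP I_lt) ltj ->; apply: mem_nth; rewrite size_A.
(* Enumerating the edge [E] gives back [t], so its color is [step_color] at [t]. *)
pose E := [set x : 'I_M | val x \in t].
have card_E : #|E| == k.+1.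
  rewrite card_set_seq ?size_map ?size_I //.
    exact: (sorted_uniq ltn_trans ltnn st).
  by apply/allP => i /t_vals /vals_lt.
have vals_E : vals E = t.
  apply: (irr_sorted_eq ltn_trans ltnn (sorted_val_enum E) st) => i.
  apply/mapP/idP => [[x]|it]; first by rewrite mem_enum inE => ? ->.
  by exists (Ordinal (vals_lt i (t_vals i it))); rewrite ?mem_enum ?inE.
have := col_c (Sub E card_E); rewrite ffunE SubK vals_E => /implyP; apply.
apply/subsetP => x; rewrite inE => /t_vals /mapP[y].
by rewrite mem_enum => yA /val_inj ->.
Qed.
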